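(* If $G$ is a connected graph with at least three vertices and maximum degree $\Delta(G)$, then \[\lceil \log_2 (1+\Delta(G))\rceil \le \Psi(L(G)) \le |V(G)| - 1.\]
   Context: All graphs are finite, simple and undirected. For a connected graph $H$, $d_H(u,v)$ denotes the distance (number of edges in a shortest path) between $u$ and $v$. A pair $\{x,y\}$ of vertices of $H$ doubly resolves a pair $\{u,v\}$ if $d_H(u,x)-d_H(u,y)\neq d_H(v,x)-d_H(v,y)$. A set $S\subseteq V(H)$ is a doubly resolving set of $H$ if every pair of distinct vertices of $H$ is doubly resolved by some pair of vertices in $S$; $\Psi(H)$ denotes the minimum cardinality of a doubly resolving set of $H$. $L(G)$ is the line graph of $G$: its vertices are the edges of $G$, two being adjacent iff they share an end vertex. *)

(* Defs.v *)
From mathcomp Require Import all_boot all_order all_algebra.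

Set Implicit Arguments.
Unset Strict Implicit.
Unset Printing Implicit Defensive.

Import Order.TTheory GRing.Theory Num.Theory.

Record sgraph := SGraph {
  vertex :> finType;
  adj : rel vertex;
  adj_sym : symmetric adj;
  adj_irrefl : irreflexive adj }.

Definition connected (G : sgraph) : Prop :=
  forall u v : G, connect (@adj G) u v.

Definition degree (G : sgraph) (v : G) : nat := #|[set w | adj v w]|.

Definition max_degree (G : sgraph) : nat := \max_(v : G) degree v.

Definition walk_of_length (G : sgraph) (u v : G) (n : nat) : bool :=
  [exists p : n.-tuple G, path (@adj G) u p && (last u p == v)].

(* A shortest path has fewer than #|G| edges, so only those lengths need to be
   searched; the value is the junk #|G| when u and v are not connected. *)
Definition dist (G : sgraph) (u v : G) : nat :=
  \big[minn/#|G|]_(n < #|G| | walk_of_length u v n) n.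

Definition doubly_resolves (G : sgraph) (x y u v : G) : bool :=
  ((dist u x)%:Z - (dist u y)%:Z != (dist v x)%:Z - (dist v y)%:Z)%R.

(* Allowing x = y is harmless: such a pair doubly resolves nothing. *)
Definition doubly_resolving_set (G : sgraph) (S : {set G}) : bool :=
  [forall u, forall v, (u != v) ==>
    [exists x in S, exists y in S, doubly_resolves x y u v]].

(* In a connected graph the whole vertex set is doubly resolving, so the
   default value #|G| of the minimum is itself one of the cardinalities. *)
Definition Psi (G : sgraph) : nat :=
  \big[minn/#|G|]_(S : {set G} | doubly_resolving_set S) #|S|.

Definition edges (G : sgraph) : {set {set G}} :=
  [set A | [exists u, exists v, adj u v && (A == [set u; v])]].

Section LineGraph.
Variable G : sgraph.

Definition line_vertex : finType := {A : {set G} | A \in edges G}.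

Definition line_adj (a b : line_vertex) : bool :=
  (a != b) && (val a :&: val b != set0).

Lemma line_adj_sym : symmetric line_adj.
Proof. by move=> a b; rewrite /line_adj eq_sym setIC. Qed.

Lemma line_adj_irrefl : irreflexive line_adj.
Proof. by move=> a; rewrite /line_adj eqxx. Qed.

Definition line_graph : sgraph := SGraph line_adj_sym line_adj_irrefl.
End LineGraph.

Section MinimumSpecifications.

Lemma bigminn_attained (I : finType) (P : pred I) (F : I -> nat) (m : nat) :
  let b := \big[minn/m]_(i | P i) F i in
  b = m \/ exists2 i, P i & F i = b.
Proof.
apply: (big_ind (fun b => b = m \/ exists2 i, P i & F i = b)) => [|x y Hx Hy|i].
- by left.
- by rewrite /minn; case: ifP.
- by right; exists i.
Qed.

Lemma bigminn_le (I : finType) (P : pred I) (F : I -> nat) (m : nat) (i : I) :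
  P i -> \big[minn/m]_(j | P j) F j <= F i.
Proof.
move=> Pi; rewrite unlock; move: (mem_index_enum i).
elim: (index_enum I) => //= j s IH; rewrite inE => /orP[/eqP <-|/IH].
  by rewrite Pi geq_minl.
by case: ifP => // _; apply: leq_trans; rewrite geq_minr.
Qed.

Variable G : sgraph.

Lemma dist_le (u : G) (p : seq G) :
  path (@adj G) u p -> dist u (last u p) <= size p.
Proof.
case/shortenP => q uq q_uniq q_sub.
have szq : size q < #|G| by have /card_uniqP /= <- := q_uniq; apply: max_card.
apply: (@leq_trans (size q)); last first.
  by apply: uniq_leq_size => //; case/andP: q_uniq.
apply: (@bigminn_le _ _ (fun n : 'I__ => n : nat) _ (Ordinal szq)).
by apply/existsP; exists (in_tuple q); rewrite uq eqxx.
Qed.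

Lemma dist_attained (u v : G) : connect (@adj G) u v ->
  exists p, [/\ path (@adj G) u p, last u p = v & size p = dist u v].
Proof.
case/connectP=> p0 /shortenP[q uq q_uniq _] ->.
have szq : size q < #|G| by have /card_uniqP /= <- := q_uniq; apply: max_card.
have [E|[n /existsP[p /andP[up /eqP lp]] En]] := bigminn_attained
  (fun n : 'I_#|G| => walk_of_length u (last u q) n) (fun n => n : nat) #|G|.
  by have := dist_le uq; rewrite /dist E leqNgt szq.
by exists p; split; rewrite // size_tuple.
Qed.

Lemma dist_eq0 (u v : G) : connect (@adj G) u v -> (dist u v == 0) = (u == v).
Proof.
move=> uv; apply/idP/eqP => [|<-].
  by have [p [_ <- <-]] := dist_attained uv; case: p.
by rewrite -leqn0; apply: (@dist_le u [::]).
Qed.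

Lemma doubly_resolving_setT : connected G -> doubly_resolving_set [set: G].
Proof.
move=> cG; apply/forallP=> u; apply/forallP=> v; apply/implyP=> uv.
apply/existsP; exists u; rewrite inE; apply/existsP; exists v; rewrite inE /=.
have E (w : G) : dist w w = 0 by apply/eqP; rewrite dist_eq0 ?connect0.
rewrite /doubly_resolves !E sub0r subr0.
apply: contra uv => /eqP H; rewrite -(dist_eq0 (cG u v)) -eqz_nat -oppr_eq0 H.
by rewrite eq_le -{1}H oppr_le0 !lez_nat.
Qed.

Lemma Psi_le (S : {set G}) : doubly_resolving_set S -> Psi G <= #|S|.
Proof. exact: bigminn_le. Qed.

Lemma Psi_attained : connected G ->
  exists2 S : {set G}, doubly_resolving_set S & #|S| = Psi G.
Proof.
move=> cG; have [E|//] := bigminn_attained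
  (@doubly_resolving_set G) (fun S : {set G} => #|S|) #|G|.
by exists [set: G]; [exact: doubly_resolving_setT | rewrite cardsT /Psi E].
Qed.

End MinimumSpecifications.

(* Main.v *)
(** Lower bound: the edges at a vertex of maximum degree form a clique of the
    line graph, so the distances from them to a landmark [s] take at most two
    consecutive values. Recording which one gives an injective code of the
    clique by subsets of the resolving set [S], and [set0] and [S] cannot both
    be codes, since these two vectors differ by a constant. Hence
    [Delta < 2 ^ #|S|].

    Upper bound: fix a root [r], give every other vertex a parent closer to [r],
    and let [T] be the set of the parent edges; it contains all edges at [r].
    An edge [uv] outside [T] is adjacent to the two distinct parent edges of [u]
    and [v], and an edge of [T] is at distance 0 from itself; so no edge is
    strictly farther than another from all of [T]. If [e] and [f] are not
    doubly resolved by [T], their distances to [T] therefore coincide, and if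
    they were distinct both would lie outside [T] and each would meet the
    parent edges of the ends of the other, which is impossible by comparing
    depths. *)
Require Import Defs.
From mathcomp Require Import all_boot zify.

Set Implicit Arguments.
Unset Strict Implicit.
Unset Printing Implicit Defensive.

(** * Distances in a connected graph and the clique bound *)

Section Distance.
Variable G : sgraph.
Hypothesis G_connected : connected G.

Lemma distxx (u : G) : dist u u = 0.
Proof. by apply/eqP; rewrite dist_eq0 ?connect0. Qed.

Lemma dist_adj_leS (u v s : G) : adj u v -> dist u s <= (dist v s).+1.
Proof.
move=> uv; have [p [vp <- <-]] := dist_attained (G_connected v s).
by apply: (@dist_le G u (v :: p)); rewrite /= uv.
Qed.

Lemma dist_eq1 (u v : G) : adj u v -> dist u v = 1.
Proof.
move=> uv; apply/eqP; rewrite eqn_leq -{1}(distxx v) dist_adj_leS //.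
rewrite lt0n dist_eq0 //; apply: contraTneq uv => ->.
by rewrite adj_irrefl.
Qed.

Lemma exists_adj_closer (u r : G) :
  u != r -> exists2 w, adj u w & dist w r < dist u r.
Proof.
have [[|w p] /= [up lp <-]] := dist_attained (G_connected u r).
  by rewrite lp eqxx.
case/andP: up => uw wp _; exists w => //.
by rewrite -lp ltnS dist_le.
Qed.

(** Moving the subtracted terms across turns integer differences into sums of naturals. *)
Lemma doubly_resolvesPn (x y u v : G) :
  reflect (dist u x + dist v y = dist v x + dist u y)
          (~~ doubly_resolves x y u v).
Proof. by rewrite negbK; apply: (iffP eqP); lia. Qed.

Lemma doubly_resolving_setP (S : {set G}) :
  reflect (forall u v, {in S &, forall x y,
             dist u x + dist v y = dist v x + dist u y} -> u = v)
          (doubly_resolving_set S).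
Proof.
apply: (iffP forallP) => [dS u v E|dS u].
  apply/eqP; have := forallP (dS u) v; apply: contraTT => uv.
  rewrite uv /=; apply/exists_inPn => x xS; apply/exists_inPn => y yS.
  exact/doubly_resolvesPn/E.
apply/forallP=> v; apply: contraTT isT; rewrite negb_imply => /andP[uv].
move/exists_inPn => nS; case/eqP: uv; apply: dS => x y xS yS.
by apply/doubly_resolvesPn; have /exists_inPn := nS x xS; apply.
Qed.

Lemma clique_lt_exp_doubly_resolving (A S : {set G}) :
    {in A &, forall a b, a != b -> adj a b} -> 1 < #|A| ->
  doubly_resolving_set S -> #|A| < 2 ^ #|S|.
Proof.
move=> clA /card_gt1P[a0 [b0 [a0A _ /eqP a0b0]]] /doubly_resolving_setP dS.
pose near s := [arg min_(a < a0 in A) dist a s].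
pose code a := [set s in S | dist (near s) s < dist a s].
have codeE a s : a \in A -> s \in S ->
    dist a s = dist (near s) s + (s \in code a).
  move=> aA sS; rewrite inE sS /near; case: arg_minnP => //= m mA min_m.
  have := min_m a aA; have [-> _|am] := eqVneq a m; first by rewrite ltnn addn0.
  by have := dist_adj_leS s (clA _ _ aA mA am); case: ltnP; lia.
have code_inj : {in A &, injective code}.
  move=> a b aA bA Eab; apply: dS => x y xS yS.
  by rewrite (codeE a x) ?(codeE a y) ?(codeE b x) ?(codeE b y) // Eab.
rewrite -card_powerset -(card_in_imset code_inj); apply: proper_card.
rewrite properEneq andbC; apply/andP; split.
  by apply/subsetP=> _ /imsetP[a _ ->]; rewrite inE /code setIdE subsetIl.
apply/eqP=> /setP codeP.
have := codeP set0; rewrite inE sub0set => /imsetP[a aA Ea].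
(* If [a] has code [set0] and [b] has code [S], then [b] is exactly one farther than [a] from every
   landmark, so [a = b]. This forces [S] to be empty, and an empty [S] cannot separate [a0] from
   [b0]. *)
have := codeP S; rewrite inE subxx => /imsetP[b bA Eb].
have ab : a = b.
  apply: dS => x y xS yS; rewrite (codeE a x) ?(codeE a y) //.
  rewrite (codeE b x) ?(codeE b y) // -Ea -Eb !in_set0 xS yS.
  by rewrite !addn0 !addn1 addnS addSn.
by apply: a0b0; apply: dS => x y; rewrite Eb -ab -Ea in_set0.
Qed.

(** Supplies the clique of size at least 2 that the clique bound requires. If all degrees were at
    most 1, a closed neighbourhood [B] would be closed under adjacency, hence all of [G], with at
    most two vertices. *)
Lemma max_degree_ge2 : 2 < #|G| -> 1 < max_degree G.
Proof.
move=> G3; rewrite ltnNge; apply/negP=> /bigmax_leqP deg1.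
have [v _] : exists v : G, v \in G by apply/card_gt0P; apply: leq_trans G3.
pose B := v |: [set w | adj v w].
have closedB : closed (@adj G) (mem B).
  apply: intro_closed => [|x y xy]; first exact: sym_connect_sym (@adj_sym G).
  rewrite !inE => /predU1P[<-|vx]; first by rewrite xy orbT.
  suff -> : y = v by rewrite eqxx.
  by apply: (card_le1_eqP (deg1 x isT)); rewrite inE // adj_sym.
have := G3; rewrite ltnNge => /negP; apply.
apply: leq_trans (_ : #|B| <= 2); last first.
  by rewrite cardsU1 (leq_add (leq_b1 _) (deg1 v isT)).
apply/subset_leq_card/subsetP => x _.
by rewrite -(closed_connect closedB (G_connected v x)) !inE eqxx.
Qed.

End Distance.

(** * The line graph and the lower bound *)

Section LineGraphFacts.
Variable G : sgraph.
Implicit Types (e f g : line_graph G) (u v w : G).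

Lemma line_vertexP e : exists u v, adj u v /\ val e = [set u; v].
Proof.
have := valP e; rewrite inE => /existsP[u /existsP[v /andP[uv /eqP Ee]]].
by exists u, v.
Qed.

Lemma line_vertex_of u v : adj u v -> exists e, val e = [set u; v].
Proof.
move=> uv; have uvE : [set u; v] \in edges G.
  by rewrite inE; apply/existsP; exists u; apply/existsP; exists v; rewrite uv /=.
by exists (Sub [set u; v] uvE).
Qed.

Lemma line_adj_common e f u :
  e != f -> u \in val e -> u \in val f -> @adj (line_graph G) e f.
Proof.
move=> ef ue uf; rewrite /= /line_adj ef /=.
by apply/set0Pn; exists u; rewrite inE ue.
Qed.

Lemma line_graph_connected : connected G -> connected (line_graph G).
Proof.
have meet e f u : u \in val e -> u \in val f -> connect (@adj (line_graph G)) e f.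
  move=> ue uf; have [->|ef] := eqVneq e f; first exact: connect0.
  exact/connect1/(line_adj_common ef ue uf).
move=> cG e f.
have [u [u' [_ Ee]]] := line_vertexP e; have [v [v' [_ Ef]]] := line_vertexP f.
have ue : u \in val e by rewrite Ee set21.
have : v \in val f by rewrite Ef set21.
(* A path in [G] from an end of [e] to an end of [f] is followed edge by edge; consecutive edges
   share a vertex. *)
have /connectP[p up ->] := cG u v.
elim: p u e {Ee} ue up => [|w p IHp] u e ue /=; first by move=> _; apply: meet ue.
case/andP=> uw wp lf; have [g Eg] := line_vertex_of uw.
apply: connect_trans (IHp w g _ wp lf); last by rewrite Eg set22.
by apply: meet ue _; rewrite Eg set21.
Qed.

Lemma degree_le_incident u : degree u <= #|[set e : line_graph G | u \in val e]|.
Proof.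
rewrite /degree -(card_in_imset (f := fun w => [set u; w])); last first.
  move=> x y; rewrite !inE => ux uy /setP/(_ x).
  rewrite !inE eqxx orbT; case: eqP ux => [->|_ _ /esym/eqP //].
  by rewrite adj_irrefl.
apply: leq_trans (leq_imset_card val _); apply/subset_leq_card/subsetP=> B.
case/imsetP=> w; rewrite inE => uw ->; have [e Ee] := line_vertex_of uw.
by rewrite -Ee; apply: imset_f; rewrite inE Ee set21.
Qed.

Lemma up_log_max_degree_le_Psi : connected G -> 2 < #|G| ->
  up_log 2 (1 + max_degree G) <= Psi (line_graph G).
Proof.
move=> cG G3; have cL := line_graph_connected cG.
have [S dS <-] := Psi_attained cL.
have [v Ev] := eq_bigmax (@degree G) (leq_trans (isT : 0 < 3) G3).
have deg2 := max_degree_ge2 cG G3; rewrite /max_degree Ev in deg2 *.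
apply: up_log_min => //; rewrite add1n.
apply: leq_ltn_trans (degree_le_incident v) _.
apply: (clique_lt_exp_doubly_resolving cL) => //; last first.
  exact: leq_trans deg2 (degree_le_incident v).
by move=> e f; rewrite !inE => ve vf ef; apply: line_adj_common ef ve vf.
Qed.

Lemma dist_line_eq1 e f : @adj (line_graph G) e f ->
  connected G -> dist e f = 1.
Proof. by move=> ef cG; apply: dist_eq1 ef; apply: line_graph_connected. Qed.

End LineGraphFacts.

(** * Parent edges form a doubly resolving set *)

Section ParentEdges.
Variables (G : sgraph) (r : G) (parent : G -> G) (depth : G -> nat).
Hypothesis G_connected : connected G.
Hypothesis adj_parent : forall u, u != r -> adj u (parent u).
Hypothesis parent_lower : forall u, u != r -> depth (parent u) < depth u.
Hypothesis parent_root : forall u, adj u r -> parent u = r.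
Implicit Types (e f g : line_graph G) (u v w : G).

Definition parent_edges : {set line_graph G} :=
  [set e | [exists u, (u != r) && (val e == [set u; parent u])]].

Lemma card_parent_edges : #|parent_edges| <= #|G| - 1.
Proof.
rewrite -(card_imset _ val_inj) subn1 -(cardsC1 r).
apply: leq_trans (leq_imset_card (fun u => [set u; parent u]) [set~ r]).
apply/subset_leq_card/subsetP=> B /imsetP[e]; rewrite inE.
by case/existsP=> u /andP[ur /eqP ->] ->; apply: imset_f; rewrite !inE.
Qed.

Lemma parent_edgeP u : u != r ->
  exists2 s, s \in parent_edges & val s = [set u; parent u].
Proof.
move=> ur; have [s Es] := line_vertex_of (adj_parent ur).
by exists s => //; rewrite inE; apply/existsP; exists u; rewrite ur Es eqxx.
Qed.

Lemma edge_at_root_parent_edge e : r \in val e -> e \in parent_edges.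
Proof.
suff H v : adj v r -> val e = [set v; r] -> e \in parent_edges.
  have [u [v [uv Ee]]] := line_vertexP e; rewrite Ee in_set2.
  case/orP=> /eqP E; rewrite -E in uv Ee; last exact: H Ee.
  by apply: (H v); rewrite 1?adj_sym // Ee setUC.
move=> vr Ee; have vNr : v != r by apply: contraTneq vr => ->; rewrite adj_irrefl.
by rewrite inE; apply/existsP; exists v; rewrite vNr Ee parent_root /=.
Qed.

Lemma dist_parent_edge_eq1 e s u : e \notin parent_edges ->
  s \in parent_edges -> u \in val e -> u \in val s -> dist e s = 1.
Proof.
move=> eT sT ue us; apply: dist_line_eq1 => //; apply: line_adj_common ue us.
by apply: contraNneq eT => ->.
Qed.

Lemma exists_parent_edge_dist_le e f :
  exists2 s, s \in parent_edges & dist e s <= dist f s.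
Proof.
have cL := line_graph_connected G_connected.
have [eT|eT] := boolP (e \in parent_edges); first by exists e; rewrite ?distxx.
have [u [v [uv Ee]]] := line_vertexP e.
have ue : u \in val e by rewrite Ee set21.
have ve : v \in val e by rewrite Ee set22.
have neq_root w : w \in val e -> w != r.
  by move=> we; apply: contraNneq eT => wr; apply: edge_at_root_parent_edge; rewrite -wr.
have [s sT Es] := parent_edgeP (neq_root u ue).
have [t tT Et] := parent_edgeP (neq_root v ve).
have ds : dist e s = 1 by apply: dist_parent_edge_eq1 ue _; rewrite ?Es ?set21.
have dt : dist e t = 1 by apply: dist_parent_edge_eq1 ve _; rewrite ?Et ?set21.
(* Both [s] and [t] are at distance 1 from [e]; one of them must differ from [f], since [s = t]
   would make [e] itself the parent edge [s]. *)
have [fs|fs] := eqVneq f s; last first.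
  by exists s; first exact: sT; rewrite ds lt0n (dist_eq0 (cL _ _)).
exists t; first exact: tT; rewrite dt lt0n (dist_eq0 (cL _ _)) fs.
apply: contraNneq eT => st.
have vs : v \in val s by rewrite st Et set21.
suff -> : e = s by [].
have neq_uv : v != u by apply: contraTneq uv => ->; rewrite adj_irrefl.
apply: val_inj; rewrite Ee Es; move: vs.
by rewrite Es !inE (negPf neq_uv) => /eqP <-.
Qed.

(* The ends of [e] and [f] of least depth must coincide; if the edges differed,
   the other ends would be parents of each other. *)
Lemma edge_eq_of_meet_parents e f :
    e \notin parent_edges -> f \notin parent_edges ->
    {in val e, forall w, w \in val f \/ parent w \in val f} ->
    {in val f, forall w, w \in val e \/ parent w \in val e} -> e = f.
Proof.
have low g : exists u v, [/\ adj u v, val g = [set u; v] & depth u <= depth v].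
  have [u [v [uv Eg]]] := line_vertexP g.
  have [le|/ltnW le] := leqP (depth u) (depth v); first by exists u, v.
  by exists v, u; rewrite adj_sym setUC.
have neq_root g w : g \notin parent_edges -> w \in val g -> w != r.
  move=> gT wg; apply: contraNneq gT => wr.
  by apply: edge_at_root_parent_edge; rewrite -wr.
have lower g w : g \notin parent_edges -> w \in val g ->
    depth (parent w) < depth w.
  by move=> gT wg; apply: parent_lower; apply: neq_root wg.
have not_parent g w z : g \notin parent_edges -> val g = [set z; w] ->
    parent w != z.
  move=> gT Eg; apply: contraNneq (gT) => Ez; rewrite inE; apply/existsP; exists w.
  have wr : w != r by apply: neq_root gT _; rewrite Eg set22.
  by rewrite wr Ez Eg setUC eqxx.
move=> eT fT; have [u [v [uv Ee uv_le]]] := low e.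
have [x [y [xy Ef xy_le]]] := low f => meet_e meet_f.
have [ue ve] : u \in val e /\ v \in val e by rewrite Ee set21 set22.
have [xf yf] : x \in val f /\ y \in val f by rewrite Ef set21 set22.
have min_e w : w \in val e -> depth u <= depth w.
  by rewrite Ee !inE => /orP[] /eqP ->.
have min_f w : w \in val f -> depth x <= depth w.
  by rewrite Ef !inE => /orP[] /eqP ->.
have lt_u := lower e u eT ue; have lt_v := lower e v eT ve.
have lt_x := lower f x fT xf; have lt_y := lower f y fT yf.
have le_ux : depth u <= depth x.
  by case: (meet_f x xf) => /min_e // /leq_trans; apply; apply: ltnW.
have le_xu : depth x <= depth u.
  by case: (meet_e u ue) => /min_f // /leq_trans; apply; apply: ltnW.
have uf : u \in val f.
  case: (meet_e u ue) => // /min_f le_xp.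
  by have := leq_trans lt_u (leq_trans le_ux le_xp); rewrite ltnn.
have xe : x \in val e.
  case: (meet_f x xf) => // /min_e le_up.
  by have := leq_trans lt_x (leq_trans le_xu le_up); rewrite ltnn.
have uNv : u != v by apply: contraTneq uv => ->; rewrite adj_irrefl.
have xNy : x != y by apply: contraTneq xy => ->; rewrite adj_irrefl.
apply: val_inj; rewrite Ee Ef.
have pv := not_parent e v u eT Ee; have py := not_parent f y x fT Ef.
(* Either [u = y], which forces [x = v] and equal edges, or the lowest ends [u] and [x] coincide. *)
move: uf xe; rewrite Ee Ef !inE => /orP[] /eqP Eu; last first.
  case/orP=> /eqP Ex; first by rewrite Ex Eu eqxx in xNy.
  by rewrite Eu Ex setUC.
move=> _; subst x; have := meet_e v ve; have := meet_f y yf.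
rewrite Ee Ef !inE (negPf pv) (negPf py) /= [y == u]eq_sym [v == u]eq_sym.
rewrite (negPf uNv) (negPf xNy) /=.
case=> [/eqP -> //|/eqP Ey]; case=> [/eqP -> //|/eqP Ev].
by rewrite Ey in lt_y; rewrite Ev in lt_v; have := ltn_trans lt_y lt_v; rewrite ltnn.
Qed.

(** The parent edge of [w] is at distance 1 from [e], hence from [f], so [f] contains one of its
    ends. *)
Lemma meet_parent_of_dist_eq e f : e \notin parent_edges ->
    {in parent_edges, forall s, dist e s = dist f s} ->
  {in val e, forall w, w \in val f \/ parent w \in val f}.
Proof.
have cL := line_graph_connected G_connected.
move=> eT E w we.
have wr : w != r.
  by apply: contraNneq eT => wr; apply: edge_at_root_parent_edge; rewrite -wr.
have [s sT Es] := parent_edgeP wr.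
have ws : w \in val s by rewrite Es set21.
have := dist_parent_edge_eq1 eT sT we ws; rewrite E // => d1.
have [p [+ lp sz]] := dist_attained (cL f s); rewrite {}d1 in sz.
case: p sz lp => [|g []] //= _ ->; rewrite andbT => /andP[_ /set0Pn[z]].
rewrite inE Es !inE => /andP[zf] /orP[] /eqP <-; by [left | right].
Qed.

Lemma doubly_resolving_parent_edges : doubly_resolving_set parent_edges.
Proof.
have cL := line_graph_connected G_connected.
apply/doubly_resolving_setP => e f E.
(* By [E] the difference [dist e s - dist f s] is constant on the parent edges; [a] shows it is at
   most 0 and [b] at least 0. *)
have {}E : {in parent_edges, forall s, dist e s = dist f s}.
  move=> s sT; have [a aT ?] := exists_parent_edge_dist_le e f.
  have [b bT ?] := exists_parent_edge_dist_le f e.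
  by have := E s a sT aT; have := E s b sT bT; lia.
have [eT|eT] := boolP (e \in parent_edges).
  by apply/esym/eqP; rewrite -(dist_eq0 (cL _ _)) -(E e eT) distxx.
have [fT|fT] := boolP (f \in parent_edges).
  by apply/eqP; rewrite -(dist_eq0 (cL _ _)) (E f fT) distxx.
apply: (edge_eq_of_meet_parents eT fT).
  exact: meet_parent_of_dist_eq eT E.
by apply: meet_parent_of_dist_eq fT _ => s /E ->.
Qed.

End ParentEdges.

Lemma Psi_line_graph_le (G : sgraph) : connected G -> 0 < #|G| ->
  Psi (line_graph G) <= #|G| - 1.
Proof.
move=> cG /card_gt0P[r _].
pose closer u w := adj u w && (dist w r < dist u r).
(* The default value [u] is taken only at the root. *)
pose parent u := odflt u [pick w | closer u w].
have parentP u : u != r -> closer u (parent u).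
  rewrite /parent => ur; case: pickP => //= none.
  have [w uw lt] := exists_adj_closer cG ur.
  by have := none w; rewrite /closer uw lt.
apply: leq_trans (card_parent_edges r parent); apply: Psi_le.
apply: (@doubly_resolving_parent_edges G r parent (fun u => dist u r)) => //.
- by move=> u /parentP/andP[].
- by move=> u /parentP/andP[].
move=> u ur; have uNr : u != r by apply: contraTneq ur => ->; rewrite adj_irrefl.
have /andP[_] := parentP u uNr; rewrite (dist_eq1 cG ur) ltnS leqn0.
by rewrite (dist_eq0 (cG _ _)) => /eqP.
Qed.

Theorem theorem6 (G : sgraph) (G_connected : connected G) (G_ge3 : 3 <= #|G|) :
  up_log 2 (1 + max_degree G) <= Psi (line_graph G) <= #|G| - 1.
Proof.
rewrite up_log_max_degree_le_Psi // Psi_line_graph_le //.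
exact: leq_trans G_ge3.
Qed.
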